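(* Let $A,E\in\mathbb{R}^{n\times n}$ be symmetric matrices such that $\widetilde{A}:=A-E$ is symmetric positive semidefinite and $\|E\|_2\le\delta$ for some $\delta>0$. Let $I\subseteq\{1,\dots,n\}$ be the index set returned by the adaptive cross approximation algorithm (described in the context) applied to $A$ with tolerance $\mathsf{tol}$, and let $k:=|I|$. If $\rho:=\delta\,\|A(I,I)^{-1}\|_2<1$, then $$\operatorname{trace}(\widetilde{A}-\widetilde{A}_I)\le\mathsf{tol}+(n-k)\,\delta\,\frac{(1+\|W\|_2)^2}{1-\rho},$$ where $\widetilde{A}_I:=\widetilde{A}(:,I)\,\widetilde{A}(I,I)^{-1}\,\widetilde{A}(I,:)$, $W:=A(I,I)^{-1}A(I,I^c)$ and $I^c:=\{1,\dots,n\}\setminus I$.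
   Context: Notation: for index sets $I,J\subseteq\{1,\dots,n\}$, $A(I,J)$ is the submatrix of $A$ with rows in $I$ and columns in $J$; a colon denotes the full index set, so $A(:,J)$ consists of the columns indexed by $J$ and $A(I,:)$ of the rows indexed by $I$. $\|\cdot\|_2$ is the spectral norm. Adaptive cross approximation (ACA) algorithm for a symmetric matrix $A\in\mathbb{R}^{n\times n}$ with tolerance $\mathsf{tol}\ge 0$: initialize $E_I:=A$ and $I:=\emptyset$. For $k=1,2,\dots$ do: choose $i_k\in\arg\max_i (E_I)_{ii}$; replace $I$ by $I\cup\{i_k\}$; set $u_k:=E_I(:,i_k)/\sqrt{(E_I)_{i_ki_k}}$; replace $E_I$ by $E_I-u_ku_k^T$; if $\operatorname{trace}(E_I)\le\mathsf{tol}$, stop and return $I$. The algorithm is understood to be well defined, i.e. all pivots $(E_I)_{i_ki_k}$ used are positive, and to have terminated through the stopping criterion. After each step the current residual satisfies $E_I=A-A(:,I)A(I,I)^{-1}A(I,:)$. *)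

(* Defs.v *)
From mathcomp Require Import all_boot all_order all_algebra.
From mathcomp Require Import all_classical all_reals.

Set Implicit Arguments.
Unset Strict Implicit.
Unset Printing Implicit Defensive.

Import Order.TTheory GRing.Theory Num.Theory.

Local Open Scope ring_scope.

(* Submatrices A(I, J), A(I, :), A(:, J).  The rows and columns of the
   submatrix are listed in increasing order of the original indices. *)
Definition submatrix (R : Type) (m n : nat) (A : 'M[R]_(m, n))
    (I : {set 'I_m}) (J : {set 'I_n}) : 'M[R]_(#|I|, #|J|) :=
  mxsub (fun i : 'I_#|I| => enum_val i) (fun j : 'I_#|J| => enum_val j) A.

Definition row_submatrix (R : Type) (m n : nat) (A : 'M[R]_(m, n))
    (I : {set 'I_m}) : 'M[R]_(#|I|, n) :=
  rowsub (fun i : 'I_#|I| => enum_val i) A.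

Definition col_submatrix (R : Type) (m n : nat) (A : 'M[R]_(m, n))
    (J : {set 'I_n}) : 'M[R]_(m, #|J|) :=
  colsub (fun j : 'I_#|J| => enum_val j) A.

Definition norm2 (R : realType) (n : nat) (x : 'cV[R]_n) : R :=
  Num.sqrt (\sum_(i < n) x i 0 ^+ 2).

(* Using the closed unit ball rather than the unit sphere, the supremum is
   over a nonempty set even when n = 0 (the norm is then 0). *)
Definition spectral_norm (R : realType) (m n : nat) (A : 'M[R]_(m, n)) : R :=
  sup [set norm2 (A *m x) | x in [set x : 'cV[R]_n | norm2 x <= 1]]%classic.

Definition symmetric_mx (R : realType) (n : nat) (A : 'M[R]_n) : Prop :=
  A^T = A.

Definition psd_mx (R : realType) (n : nat) (A : 'M[R]_n) : Prop :=
  symmetric_mx A /\ forall x : 'cV[R]_n, 0 <= (x^T *m A *m x) 0 0.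

Definition cross_approx (R : realType) (n : nat) (A : 'M[R]_n)
    (I : {set 'I_n}) : 'M[R]_n :=
  col_submatrix A I *m invmx (submatrix A I I) *m row_submatrix A I.

Definition aca_pivot (R : realType) (n : nat) (E : 'M[R]_n) (i : 'I_n) : Prop :=
  0 < E i i /\ forall j : 'I_n, E j j <= E i i.

Definition aca_update (R : realType) (n : nat) (E : 'M[R]_n) (i : 'I_n) :
    'M[R]_n :=
  let u := (Num.sqrt (E i i))^-1 *: col i E in E - u *m u^T.

(* aca_loop tol I E J: entering the loop body with current index set I and
   residual E, adaptive cross approximation can terminate through its stopping
   criterion and return J.  It is a relation because the maximal diagonal
   entry, hence the pivot, need not be unique. *)
Inductive aca_loop (R : realType) (n : nat) (tol : R) :
    {set 'I_n} -> 'M[R]_n -> {set 'I_n} -> Prop :=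
| aca_stop (I : {set 'I_n}) (E : 'M[R]_n) (i : 'I_n) :
    aca_pivot E i ->
    \tr (aca_update E i) <= tol ->
    aca_loop tol I E (i |: I)%SET
| aca_continue (I : {set 'I_n}) (E : 'M[R]_n) (i : 'I_n) (J : {set 'I_n}) :
    aca_pivot E i ->
    tol < \tr (aca_update E i) ->
    aca_loop tol (i |: I)%SET (aca_update E i) J ->
    aca_loop tol I E J.

Definition aca_returns (R : realType) (n : nat) (tol : R) (A : 'M[R]_n)
    (I : {set 'I_n}) : Prop :=
  aca_loop tol finset.set0 A I.

(* Main.v *)
Require Import Defs.
From mathcomp Require Import all_boot all_order all_algebra.
From mathcomp Require Import all_classical all_reals.
From mathcomp Require Import ring lra.

(** Write P for the matrix that selects the rows in I, Q for the one that
    selects the remaining rows, K = P A P^T = A(I,I), and At = A - E.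

    The argument compares Schur complements through the variational principle
    for the positive semidefinite matrix At: for every V = 1 - P^T X, the trace
    of the Schur complement At - At_I is at most tr (V^T At V)
    ([mxtrace_schur_le]).  The choice V = 1 - P^T K^-1 P A is adapted to A
    instead of At: it gives V^T A V = A - A_I exactly, so
      tr (At - At_I) <= tr (A - A_I) - tr (V^T E V).
    Both terms are controlled separately.

    - The loop of adaptive cross approximation keeps the identity
      residual = A - A_I, so the stopping test says tr (A - A_I) <= tol
      ([aca_loop_residual]).  The proof characterizes the residual without
      inverses ([aca_invariant]): it is obtained from A by subtracting
      combinations of the columns in I, and its rows in I vanish.
    - V kills the coordinates in I, so V = N Q with N = Q^T - P^T W.  The n - k
      columns of N have squared length 1 + |W e_j|^2 <= 1 + ||W||^2, and a
      quadratic form in E is at least - delta times the squared length; hence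
      - tr (V^T E V) <= (n - k) delta (1 + ||W||^2)
      ([mxtrace_schur_perturbation]).

    The condition rho < 1 makes At(I,I) invertible
    ([perturbed_submatrix_unitmx]), and, since 0 <= rho < 1,
    1 + ||W||^2 <= (1 + ||W||)^2 / (1 - rho). *)

Set Implicit Arguments.
Unset Strict Implicit.
Unset Printing Implicit Defensive.

Import Order.TTheory GRing.Theory Num.Theory.

Local Open Scope ring_scope.

(** * Submatrices as products with selection matrices *)

(** Expressing submatrices as products P A Q^T turns all identities between
    index blocks into matrix algebra governed by the relations P P^T = 1,
    P Q^T = 0 and P^T P + Q^T Q = 1. *)
Definition selection_mx (R : nzRingType) (n : nat) (I : {set 'I_n}) :
    'M[R]_(#|I|, n) := row_submatrix 1%:M I.
Arguments selection_mx R [n] I.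

Lemma row_submatrixE (R : nzRingType) (m n : nat) (A : 'M[R]_(m, n))
    (I : {set 'I_m}) : row_submatrix A I = selection_mx R I *m A.
Proof. by rewrite /selection_mx /row_submatrix mul_rowsub_mx mul1mx. Qed.

Lemma col_submatrixE (R : nzRingType) (m n : nat) (A : 'M[R]_(m, n))
    (J : {set 'I_n}) : col_submatrix A J = A *m (selection_mx R J)^T.
Proof.
by rewrite /selection_mx /row_submatrix trmx_mxsub trmx1 mulmx_colsub mulmx1.
Qed.

Lemma submatrixE (R : nzRingType) (m n : nat) (A : 'M[R]_(m, n))
    (I : {set 'I_m}) (J : {set 'I_n}) :
  submatrix A I J = selection_mx R I *m A *m (selection_mx R J)^T.
Proof.
rewrite -row_submatrixE -col_submatrixE.
by apply/matrixP => i j; rewrite !mxE.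
Qed.

Lemma selection_mx_disjoint (R : nzRingType) (n : nat) (I J : {set 'I_n}) :
  [disjoint I & J] -> selection_mx R I *m (selection_mx R J)^T = 0.
Proof.
move=> dIJ; rewrite -[selection_mx R I]mulmx1 -submatrixE.
apply/matrixP => i j; rewrite !mxE.
case: eqP => // eij; have := disjointFr dIJ (enum_valP i).
by rewrite eij enum_valP.
Qed.

Lemma selection_mxK (R : nzRingType) (n : nat) (I : {set 'I_n}) :
  selection_mx R I *m (selection_mx R I)^T = 1%:M.
Proof.
rewrite -[X in X *m _]mulmx1 -submatrixE.
by apply/matrixP => i j; rewrite !mxE (inj_eq enum_val_inj).
Qed.

Lemma selection_mxTKE (R : nzRingType) (n : nat) (I : {set 'I_n}) (i j : 'I_n) :
  ((selection_mx R I)^T *m selection_mx R I) i j = ((i == j) && (i \in I))%:R.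
Proof.
rewrite mxE; under eq_bigr do rewrite !mxE.
rewrite -(big_enum_val (fun a => (a == i)%:R * (a == j)%:R)) /=.
case: (boolP (i \in I)) => iI.
  rewrite (bigD1 i) //= eqxx mul1r big1 ?addr0 ?andbT // => a /andP[_].
  by move=> /negPf->; rewrite mul0r.
rewrite andbF big1 // => a aI; case: eqP => [ai|]; last by rewrite mul0r.
by move: iI; rewrite -ai aI.
Qed.

Lemma selection_mx_complement (R : nzRingType) (n : nat) (I : {set 'I_n}) :
  (selection_mx R I)^T *m selection_mx R I
  + (selection_mx R (~: I)%SET)^T *m selection_mx R (~: I)%SET = 1%:M.
Proof.
apply/matrixP => i j; rewrite mxE !selection_mxTKE inE mxE.
by case: (i \in I); rewrite ?andbT ?andbF ?addr0 ?add0r.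
Qed.

(** * Positive semidefinite matrices and Schur complements *)

Lemma unitmx_mulmx_inj (F : fieldType) (n : nat) (M : 'M[F]_n) :
  (forall x : 'cV_n, M *m x = 0 -> x = 0) -> M \in unitmx.
Proof.
move=> inj; rewrite -unitmx_tr -row_free_unit; apply/row_freeP.
have : kermx M^T = 0.
  apply/row_matrixP => i; rewrite row0; apply: trmx_inj; rewrite trmx0.
  apply: inj; apply: trmx_inj.
  by rewrite trmx_mul trmxK -row_mul mulmx_ker row0 trmx0.
by move/eqP; rewrite kermx_eq0 => /row_freeP.
Qed.

Lemma psd_congr (R : realType) (m n : nat) (M : 'M[R]_m) (N : 'M[R]_(m, n)) :
  psd_mx M -> psd_mx (N^T *m M *m N).
Proof.
case=> sM pM; split; first by rewrite /symmetric_mx !trmx_mul trmxK sM mulmxA.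
by move=> x; have := pM (N *m x); rewrite trmx_mul !mulmxA.
Qed.

Lemma psd_invmx (R : realType) (n : nat) (M : 'M[R]_n) :
  M \in unitmx -> psd_mx M -> psd_mx (invmx M).
Proof.
move=> uM pM; have sM : M^T = M by case: pM.
have := @psd_congr _ _ _ M (invmx M) pM.
by rewrite trmx_inv sM mulVmx // mul1mx.
Qed.

Lemma quad_delta_mx (R : nzRingType) (n : nat) (M : 'M[R]_n) (i : 'I_n) :
  ((delta_mx i 0 : 'cV_n)^T *m M *m (delta_mx i 0 : 'cV_n)) 0 0 = M i i.
Proof. by rewrite trmx_delta -rowE -colE !mxE. Qed.

Lemma psd_mxtrace_ge0 (R : realType) (n : nat) (M : 'M[R]_n) :
  psd_mx M -> 0 <= \tr M.
Proof. by case=> _ pM; apply: sumr_ge0 => i _; rewrite -quad_delta_mx. Qed.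

(** The Schur complement S of K in M is the least value of the quadratic form
    of M over the vectors with prescribed coordinates outside the block.  Since
    S P^T = 0, S is unchanged by congruence with V = 1 - P^T X, and so
    V^T M V - S = V^T (M - S) V = (P M V)^T K^-1 (P M V), which is positive
    semidefinite. *)
Lemma mxtrace_schur_le (R : realType) (k n : nat) (M : 'M[R]_n)
    (P X : 'M[R]_(k, n)) (V := 1%:M - P^T *m X) :
  psd_mx M -> P *m M *m P^T \in unitmx ->
  \tr (M - M *m P^T *m invmx (P *m M *m P^T) *m (P *m M))
    <= \tr (V^T *m M *m V).
Proof.
move=> pM uK; have sM : M^T = M by case: pM.
set K := P *m M *m P^T in uK *; set S := M - _.
have SP : S *m P^T = 0.
  by rewrite /S mulmxBl -!mulmxA (mulmxA P M) -/K mulVmx // mulmx1 subrr.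
have sK : K^T = K by rewrite !trmx_mul trmxK sM mulmxA.
have sS : S^T = S.
  by rewrite /S linearB /= !trmx_mul trmxK trmx_inv sK sM !mulmxA.
have SV : S *m V = S by rewrite /V mulmxBr mulmx1 mulmxA SP mul0mx subr0.
have VSV : V^T *m S *m V = S.
  by rewrite -mulmxA SV -{1}sS -trmx_mul SV.
have pK : psd_mx K by have := @psd_congr _ _ _ M P^T pM; rewrite trmxK.
rewrite -subr_ge0 -raddfB /= -{1}VSV -mulmxBl -mulmxBr /S opprB addrC subrK.
have -> : V^T *m (M *m P^T *m invmx K *m (P *m M)) *m V =
    (P *m M *m V)^T *m invmx K *m (P *m M *m V).
  by rewrite !trmx_mul sM !mulmxA.
exact/psd_mxtrace_ge0/psd_congr/psd_invmx.
Qed.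

(** * The spectral norm *)

Lemma norm2_ge0 (R : realType) (n : nat) (x : 'cV[R]_n) : 0 <= norm2 x.
Proof. exact: sqrtr_ge0. Qed.

Lemma sqr_norm2 (R : realType) (n : nat) (x : 'cV[R]_n) :
  norm2 x ^+ 2 = (x^T *m x) 0 0.
Proof.
rewrite sqr_sqrtr; last by apply: sumr_ge0 => i _; exact: sqr_ge0.
by rewrite mxE; apply: eq_bigr => i _; rewrite mxE expr2.
Qed.

Lemma norm2_eq0 (R : realType) (n : nat) (x : 'cV[R]_n) :
  norm2 x = 0 -> x = 0.
Proof.
move=> x0; have /eqP : \sum_(i < n) x i 0 ^+ 2 = 0.
  apply/eqP; rewrite eq_le sumr_ge0 ?andbT => [|i _]; last exact: sqr_ge0.
  by rewrite -sqrtr_eq0; apply/eqP.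
rewrite psumr_eq0 => [/allP x20|i _]; last exact: sqr_ge0.
apply/colP => i; rewrite mxE; apply/eqP; rewrite -sqrf_eq0.
by apply: x20; rewrite mem_index_enum.
Qed.

Lemma norm2Z (R : realType) (n : nat) (a : R) (x : 'cV[R]_n) :
  norm2 (a *: x) = `|a| * norm2 x.
Proof.
rewrite /norm2; under eq_bigr do rewrite mxE exprMn.
by rewrite -mulr_sumr sqrtrM ?sqr_ge0 // sqrtr_sqr.
Qed.

Lemma norm2_delta (R : realType) (n : nat) (i : 'I_n) :
  norm2 (delta_mx i 0 : 'cV[R]_n) = 1.
Proof.
apply/eqP; rewrite -(eqrXn2 (n := 2)) ?norm2_ge0 // expr1n sqr_norm2.
by rewrite -[X in X *m _]mulmx1 quad_delta_mx mxE eqxx.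
Qed.

(** The supremum defining the spectral norm is only meaningful once the set is
    known to be bounded; on the unit ball every coordinate is at most 1 in
    absolute value, so row sums of absolute values give a bound. *)
Lemma norm2_image_ubound (R : realType) (m n : nat) (A : 'M[R]_(m, n)) :
  has_ubound [set norm2 (A *m x) |
    x in [set x : 'cV[R]_n | norm2 x <= 1]]%classic.
Proof.
exists (Num.sqrt (\sum_i (\sum_j `|A i j|) ^+ 2)) => _ [x /= x1 <-].
have xj1 j : `|x j 0| <= 1.
  rewrite -(ler_pXn2r (n := 2)) ?nnegrE // expr1n real_normK ?num_real //.
  apply: (le_trans (y := norm2 x ^+ 2)); last first.
    exact: exprn_ile1 (norm2_ge0 _) x1.
  rewrite sqr_norm2 mxE (bigD1 j) //= mxE -expr2 lerDl.
  by apply: sumr_ge0 => i _; rewrite mxE -expr2 sqr_ge0.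
rewrite ler_sqrt; last by apply: sumr_ge0 => i _; exact: sqr_ge0.
apply: ler_sum => i _; rewrite -[leLHS]real_normK ?num_real //.
rewrite ler_pXn2r ?nnegrE ?sumr_ge0 // mxE.
apply: (le_trans (ler_norm_sum _ _ _)); apply: ler_sum => j _.
by rewrite normrM ler_piMr.
Qed.

Lemma spectral_norm_ge0 (R : realType) (m n : nat) (A : 'M[R]_(m, n)) :
  0 <= spectral_norm A.
Proof.
apply: (le_trans (norm2_ge0 (A *m 0))).
apply: ub_le_sup; first exact: norm2_image_ubound.
by exists 0 => //=; rewrite -(scale0r 0) norm2Z normr0 mul0r.
Qed.

Lemma norm2_mulmx_le (R : realType) (m n : nat) (A : 'M[R]_(m, n))
    (x : 'cV[R]_n) : norm2 (A *m x) <= spectral_norm A * norm2 x.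
Proof.
have [x0|xn0] := eqVneq (norm2 x) 0.
  by rewrite x0 (norm2_eq0 x0) mulmx0 -(scale0r 0) norm2Z normr0 mul0r mulr0.
have xgt0 : 0 < norm2 x by rewrite lt_def xn0 norm2_ge0.
have norm_inv : `|(norm2 x)^-1| = (norm2 x)^-1.
  by rewrite ger0_norm // invr_ge0 ltW.
rewrite -ler_pdivrMr // mulrC -norm_inv -norm2Z scalemxAr.
apply: ub_le_sup; first exact: norm2_image_ubound.
by exists ((norm2 x)^-1 *: x) => //=; rewrite norm2Z norm_inv mulVf.
Qed.

(** Expanding 0 <= |E x + d x|^2 with |E x| <= d |x| gives
    0 <= 2 d (d |x|^2 + x^T E x). *)
Lemma quad_form_ge (R : realType) (n : nat) (E : 'M[R]_n) (d : R)
    (x : 'cV[R]_n) :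
  0 < d -> symmetric_mx E -> spectral_norm E <= d ->
  - (d * (x^T *m x) 0 0) <= (x^T *m E *m x) 0 0.
Proof.
move=> d0 sE Ed; rewrite -sqr_norm2; set q := (_ *m E *m x) 0 0.
have Ex : norm2 (E *m x) ^+ 2 <= d ^+ 2 * norm2 x ^+ 2.
  rewrite -exprMn ler_pXn2r ?nnegrE ?mulr_ge0 ?norm2_ge0 ?(ltW d0) //.
  apply: (le_trans (norm2_mulmx_le _ _)).
  by rewrite ler_wpM2r ?norm2_ge0.
have : 0 <= norm2 (E *m x + d *: x) ^+ 2 by exact: sqr_ge0.
have -> : norm2 (E *m x + d *: x) ^+ 2 =
    norm2 (E *m x) ^+ 2 + 2 * d * q + d ^+ 2 * norm2 x ^+ 2.
  rewrite !sqr_norm2.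
  have -> : (E *m x + d *: x)^T = x^T *m E + d *: x^T.
    by rewrite raddfD /= [(d *: x)^T]linearZ /= trmx_mul sE.
  rewrite trmx_mul sE mulmxDl !mulmxDr -!scalemxAl -!scalemxAr.
  rewrite (mulmxA x^T E x) /q.
  move: (_ *m E *m (E *m x)) (x^T *m E *m x) (x^T *m x) => u v w.
  rewrite !mxE; ring.
move=> ge0; have : 0 <= 2 * d * (d * norm2 x ^+ 2 + q).
  by apply: (le_trans ge0); rewrite -subr_ge0; nra.
by rewrite pmulr_rge0 ?mulr_gt0 // -lerBlDl sub0r.
Qed.

(** The trace is the sum over the columns v of N of the forms v^T E v, each of
    which is at least - d |v|^2. *)
Lemma opp_mxtrace_congr_le (R : realType) (m n : nat) (E : 'M[R]_n)
    (N : 'M[R]_(n, m)) (d c : R) :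
  0 < d -> symmetric_mx E -> spectral_norm E <= d ->
  (forall j, (N^T *m N) j j <= c) -> - \tr (N^T *m E *m N) <= m%:R * d * c.
Proof.
move=> d0 sE Ed Nc; rewrite -sumrN -mulrA.
rewrite -[m in leRHS]card_ord mulr_natl -sumr_const.
apply: ler_sum => j _; rewrite lerNl.
apply: (le_trans (y := - (d * (N^T *m N) j j))).
  by rewrite lerN2 ler_wpM2l ?(ltW d0).
have := quad_form_ge (N *m delta_mx j 0) d0 sE Ed.
rewrite trmx_mul !mulmxA -(mulmxA _ N^T N) -(mulmxA _ N^T E) -(mulmxA _ _ N).
by rewrite !quad_delta_mx.
Qed.

(** * The residual of adaptive cross approximation *)

(** The last condition expresses that A(I,I) is injective by means of vectors
    supported in I.  Neither it nor the others mention the submatrices of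
    A indexed by I, whose dimension changes at each step; this is what makes
    the invariant easy to propagate. *)
Definition aca_invariant (R : realType) (n : nat) (A : 'M[R]_n)
    (I : {set 'I_n}) (E : 'M[R]_n) : Prop :=
  [/\ E^T = E,
      exists2 Y : 'M[R]_n, E = A - A *m Y & forall i, i \notin I -> row i Y = 0,
      forall i, i \in I -> row i E = 0
    & forall x : 'cV[R]_n, (forall i, i \notin I -> x i 0 = 0) ->
        (forall i, i \in I -> (A *m x) i 0 = 0) -> x = 0].

Lemma aca_updateE (R : realType) (n : nat) (E : 'M[R]_n) (i : 'I_n) :
  0 < E i i -> E^T = E ->
  aca_update E i = E - (E i i)^-1 *: (col i E *m row i E).
Proof.
move=> Eii sE; rewrite /aca_update linearZ /= -scalemxAl -scalemxAr scalerA.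
by rewrite -invfM -expr2 sqr_sqrtr ?ltW // tr_col sE.
Qed.

(** The pivot is positive, hence nonzero.  This lets the update clear row i of
    the residual, and it forces the new coordinate of a kernel vector of the
    enlarged block to vanish. *)
Lemma aca_invariant_update (R : realType) (n : nat) (A : 'M[R]_n)
    (I : {set 'I_n}) (E : 'M[R]_n) (i : 'I_n) :
  symmetric_mx A -> 0 < E i i -> aca_invariant A I E ->
  aca_invariant A (i |: I)%SET (aca_update E i).
Proof.
move=> sA Eii [sE [Y EY Y0] E0 inj]; rewrite aca_updateE //.
have Eii0 : E i i != 0 by rewrite gt_eqF.
have E0r a b : a \in I -> E a b = 0.
  by move=> /E0 /rowP /(_ b); rewrite !mxE.
have E0c a b : b \in I -> E a b = 0.
  by move=> bI; rewrite -sE mxE E0r.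
have Y0e a b : a \notin I -> Y a b = 0.
  by move=> /Y0 /rowP /(_ b); rewrite !mxE.
split.
- by rewrite linearB /= linearZ /= trmx_mul tr_col tr_row sE.
- (* Column i of E is A (1 - Y) e_i, so the subtracted rank-one term is again
     of the form A Z, with Z = (1 - Y) e_i (row i E) / E i i. *)
  exists (Y + (E i i)^-1 *: ((1%:M - Y) *m delta_mx i 0 *m row i E)).
    rewrite mulmxDr opprD addrA -EY -scalemxAr !mulmxA mulmxBr mulmx1 -EY.
    by rewrite colE.
  move=> a; rewrite !inE negb_or => /andP[ai aI].
  apply/rowP => b; rewrite mulmxBl mul1mx -colE.
  rewrite !mxE Y0e // add0r big1 ?mulr0 // => c _.
  by rewrite !mxE Y0e // (negPf ai) subr0 mul0r.
- move=> a; rewrite !inE => aiI; apply/rowP => b.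
  rewrite !mxE big_ord1 !mxE.
  case/orP: aiI => [/eqP->|aI]; first by rewrite mulKf ?subrr.
  by rewrite (E0r a b) // (E0r a i) // mul0r mulr0 subrr.
- move=> x x0 Ax0.
  (* E = A - Y^T A by symmetry, and Y^T only reads the entries of A x in I,
     so E x = A x.  In row i the only surviving term of E x is E i i * x i,
     and (A x) i = 0. *)
  have YAx : Y^T *m A *m x = 0.
    apply/matrixP => a b; rewrite -mulmxA ord1 !mxE big1 // => c _.
    rewrite !mxE; case: (boolP (c \in I)) => cI; last by rewrite Y0e ?mul0r.
    by have := Ax0 c; rewrite !inE cI orbT mxE => ->; rewrite ?mulr0.
  have Ex : E *m x = A *m x.
    by rewrite -sE EY linearB /= trmx_mul sA mulmxBl YAx subr0.
  have xi : x i 0 = 0.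
    have : (E *m x) i 0 = 0 by rewrite Ex Ax0 // setU11.
    rewrite mxE (bigD1 i) //= big1 ?addr0 => [/eqP|a ai].
      by rewrite mulf_eq0 (negPf Eii0) => /eqP.
    case: (boolP (a \in I)) => aI; first by rewrite E0c ?mul0r.
    by rewrite x0 ?mulr0 // !inE negb_or ai.
  apply: inj => [a aI|a aI]; last by rewrite Ax0 // !inE aI orbT.
  by have [->//|ai] := eqVneq a i; rewrite x0 // !inE negb_or ai.
Qed.

(** The factor Y is determined by the vanishing of the rows of E in I: these
    say P A = K (P Y), that is, P Y = K^-1 P A. *)
Lemma aca_invariant_residual (R : realType) (n : nat) (A : 'M[R]_n)
    (I : {set 'I_n}) (E : 'M[R]_n) :
  aca_invariant A I E ->
  submatrix A I I \in unitmx /\ E = A - cross_approx A I.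
Proof.
move=> [sE [Y EY Y0] E0 inj].
rewrite /cross_approx row_submatrixE col_submatrixE submatrixE.
set P := selection_mx R I.
have uK : P *m A *m P^T \in unitmx.
  apply: unitmx_mulmx_inj => z Kz.
  have -> : z = P *m (P^T *m z) by rewrite mulmxA selection_mxK mul1mx.
  rewrite (inj (P^T *m z)) ?mulmx0 // => i iI.
    rewrite mxE big1 // => j _; rewrite !mxE.
    case: eqP => [ij|_]; last by rewrite mul0r.
    by move: iI; rewrite -ij enum_valP.
  have /colP /(_ (enum_rank_in iI i)) := Kz.
  by rewrite -!mulmxA -row_submatrixE !mxE enum_rankK_in.
split=> //.
have YP : Y = P^T *m (P *m Y).
  apply/matrixP => i j; rewrite mulmxA mxE (bigD1 i) //= selection_mxTKE eqxx.
  rewrite big1 ?addr0 => [|a ai]; last first.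
    by rewrite selection_mxTKE eq_sym (negPf ai) mul0r.
  case: (boolP (i \in I)) => iI; first by rewrite mul1r.
  by rewrite mul0r; have /rowP /(_ j) := Y0 _ iI; rewrite !mxE.
have PE : P *m E = 0.
  apply/matrixP => a b; rewrite -row_submatrixE !mxE.
  by have /rowP /(_ b) := E0 _ (enum_valP a); rewrite !mxE.
have PA : P *m A = P *m A *m P^T *m (P *m Y).
  by apply/eqP; rewrite -subr_eq0 -!mulmxA -YP -mulmxBr -EY PE.
set K := _ *m P^T in uK PA *.
by rewrite -mulmxA PA mulKmx // -mulmxA -YP.
Qed.

Lemma aca_invariant_init (R : realType) (n : nat) (A : 'M[R]_n) :
  symmetric_mx A -> aca_invariant A finset.set0 A.
Proof.
move=> sA; split=> //.
- by exists 0 => [|i _]; rewrite ?mulmx0 ?subr0 ?row0.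
- by move=> i; rewrite inE.
- by move=> x x0 _; apply/colP => i; rewrite mxE x0 ?inE.
Qed.

Lemma aca_loop_residual (R : realType) (n : nat) (A : 'M[R]_n) (tol : R)
    (I J : {set 'I_n}) (E : 'M[R]_n) :
  symmetric_mx A -> aca_invariant A I E -> aca_loop tol I E J ->
  submatrix A J J \in unitmx /\ \tr (A - cross_approx A J) <= tol.
Proof.
move=> sA inv loop; elim: loop inv => {I E J}
  [I E i [Eii _] trE|I E i J [Eii _] _ _ IH] inv.
  by have [uK <-] := aca_invariant_residual (aca_invariant_update sA Eii inv).
by apply: IH; apply: aca_invariant_update.
Qed.

(** * Perturbation of the Schur complement *)

Lemma norm2_selection_mx (R : realType) (n : nat) (I : {set 'I_n})
    (z : 'cV[R]_#|I|) : norm2 ((selection_mx R I)^T *m z) = norm2 z.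
Proof.
apply/eqP; rewrite -(eqrXn2 (n := 2)) ?norm2_ge0 // !sqr_norm2.
by rewrite trmx_mul trmxK mulmxA -(mulmxA z^T) selection_mxK mulmx1.
Qed.

Lemma norm2_selection_mx_le (R : realType) (n : nat) (I : {set 'I_n})
    (x : 'cV[R]_n) : norm2 (selection_mx R I *m x) <= norm2 x.
Proof.
rewrite -(ler_pXn2r (n := 2)) ?nnegrE ?norm2_ge0 // !sqr_norm2.
set P := selection_mx R I; set Q := selection_mx R (~: I)%SET.
have -> : x^T *m x = (P *m x)^T *m (P *m x) + (Q *m x)^T *m (Q *m x).
  rewrite !trmx_mul -!mulmxA -mulmxDr !mulmxA -mulmxDl.
  by rewrite selection_mx_complement mul1mx.
by rewrite [leRHS]mxE lerDl -sqr_norm2 sqr_ge0.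
Qed.

(** A kernel vector z of (A - E)(I,I) satisfies z = A(I,I)^-1 E(I,I) z, hence
    |z| <= rho |z| with rho < 1. *)
Lemma perturbed_submatrix_unitmx (R : realType) (n : nat) (I : {set 'I_n})
    (A E : 'M[R]_n) (d : R) :
  spectral_norm E <= d -> submatrix A I I \in unitmx ->
  d * spectral_norm (invmx (submatrix A I I)) < 1 ->
  submatrix (A - E) I I \in unitmx.
Proof.
move=> Ed uK rho1; apply: unitmx_mulmx_inj => z.
set K := submatrix A I I in uK rho1 *.
have -> : submatrix (A - E) I I = K - submatrix E I I.
  by apply/matrixP => i j; rewrite !mxE.
move/eqP; rewrite mulmxBl subr_eq0 => /eqP Kz.
have zE : z = invmx K *m (submatrix E I I *m z) by rewrite -Kz mulKmx.
have z_le : norm2 z <= d * spectral_norm (invmx K) * norm2 z.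
  rewrite {1}zE; apply: (le_trans (norm2_mulmx_le _ _)).
  rewrite mulrAC mulrC ler_wpM2r ?spectral_norm_ge0 // submatrixE -!mulmxA.
  apply: (le_trans (norm2_selection_mx_le _ _)).
  apply: (le_trans (norm2_mulmx_le _ _)).
  by rewrite norm2_selection_mx ler_wpM2r ?norm2_ge0.
apply: norm2_eq0; apply/eqP; rewrite eq_le norm2_ge0 andbT.
rewrite -(pmulr_rle0 (x := 1 - d * spectral_norm (invmx K))) ?subr_gt0 //.
by rewrite mulrBl mul1r subr_le0.
Qed.

(** The matrix V = 1 - P^T K^-1 P A is admissible in the variational bound for
    A - E and satisfies V^T A V = A - A_I, so the error comes only from E; it
    acts through the columns of N = Q^T - P^T W. *)
Lemma mxtrace_schur_perturbation (R : realType) (n : nat) (A E : 'M[R]_n)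
    (d : R) (I : {set 'I_n})
    (W := invmx (submatrix A I I) *m submatrix A I (~: I)%SET) :
  symmetric_mx E -> psd_mx (A - E) -> 0 < d -> spectral_norm E <= d ->
  submatrix A I I \in unitmx -> submatrix (A - E) I I \in unitmx ->
  \tr ((A - E) - cross_approx (A - E) I) <=
    \tr (A - cross_approx A I)
    + #|~: I|%SET%:R * d * (1 + spectral_norm W ^+ 2).
Proof.
rewrite /W /cross_approx !row_submatrixE !col_submatrixE !submatrixE.
set P := selection_mx R I; set Q := selection_mx R (~: I)%SET.
move=> sE pAt d0 Ed; set K := P *m A *m P^T => uK uKt.
set W' := invmx K *m _.
apply: (le_trans (mxtrace_schur_le (invmx K *m (P *m A)) pAt uKt)).
set V := 1%:M - _; set S := A - _ *m _.
have PS : P *m S = 0 by rewrite /S mulmxBr !mulmxA -/K mulmxV // mul1mx subrr.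
have AV : A *m V = S by rewrite /V /S mulmxBr mulmx1 !mulmxA.
have VAV : V^T *m A *m V = S.
  have -> : V^T = 1%:M - (invmx K *m (P *m A))^T *m P.
    by rewrite [LHS]linearB /= trmx1 trmx_mul trmxK.
  rewrite -mulmxA AV mulmxBl mul1mx.
  by rewrite -mulmxA PS mulmx0 subr0.
have VP : V *m P^T = 0.
  by rewrite /V mulmxBl mul1mx -!mulmxA (mulmxA P) -/K mulVmx // mulmx1 subrr.
have PQ : P *m Q^T = 0.
  by apply: selection_mx_disjoint; rewrite finset.disjoints_subset finset.setCK.
have QP : Q *m P^T = 0 by apply: trmx_inj; rewrite trmx_mul trmxK trmx0.
set N := Q^T - P^T *m W'.
have VQ : V *m Q^T = N by rewrite /V /N /W' mulmxBl mul1mx !mulmxA.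
have VN : V = N *m Q.
  rewrite -VQ -[LHS]mulmx1 -(selection_mx_complement R I) mulmxDr !mulmxA.
  by rewrite VP mul0mx add0r.
have NN : N^T *m N = 1%:M + W'^T *m W'.
  have -> : N^T = Q - W'^T *m P by rewrite [LHS]linearB /= trmx_mul !trmxK.
  have PN : P *m N = - W'.
    by rewrite mulmxBr PQ sub0r mulmxA selection_mxK mul1mx.
  have QN : Q *m N = 1%:M.
    by rewrite mulmxBr selection_mxK mulmxA QP mul0mx subr0.
  by rewrite mulmxBl QN -mulmxA PN mulmxN opprK.
rewrite [V^T *m _]mulmxBr [X in \tr X]mulmxBl VAV raddfB /= lerD2l.
rewrite VN trmx_mul !mulmxA mxtrace_mulC !mulmxA selection_mxK mul1mx.
apply: opp_mxtrace_congr_le => // j.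
rewrite NN mxE mxE eqxx lerD2l -quad_delta_mx.
rewrite mulmxA -trmx_mul -mulmxA -sqr_norm2.
rewrite ler_pXn2r ?nnegrE ?norm2_ge0 ?spectral_norm_ge0 //.
by apply: (le_trans (norm2_mulmx_le _ _)); rewrite norm2_delta mulr1.
Qed.

Theorem lemma3p2 (R : realType) (n : nat) (A E : 'M[R]_n) (delta tol : R)
    (I : {set 'I_n}) :
  symmetric_mx A ->
  symmetric_mx E ->
  psd_mx (A - E) ->
  0 < delta ->
  spectral_norm E <= delta ->
  0 <= tol ->
  aca_returns tol A I ->
  let At : 'M[R]_n := A - E in
  let k : nat := #|I| in
  let W := invmx (submatrix A I I) *m submatrix A I (~: I)%SET in
  let rho := delta * spectral_norm (invmx (submatrix A I I)) in
  rho < 1 ->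
  \tr (At - cross_approx At I) <=
    tol + (n%:R - k%:R) * delta * ((1 + spectral_norm W) ^+ 2 / (1 - rho)).
Proof.
move=> sA sE pAt d0 Ed _ aca At k W rho rho1.
have [uK trA] := aca_loop_residual sA (aca_invariant_init sA) aca.
have uKt := perturbed_submatrix_unitmx Ed uK rho1.
apply: (le_trans (mxtrace_schur_perturbation sE pAt d0 Ed uK uKt)).
rewrite -/W; have -> : #|~: I|%SET%:R = n%:R - k%:R :> R.
  by rewrite -[n in RHS]card_ord -(cardsC I) natrD addrAC subrr add0r.
apply: lerD => //; have W0 := spectral_norm_ge0 W.
have nk0 : 0 <= n%:R - k%:R :> R.
  by rewrite subr_ge0 ler_nat -[leqRHS]card_ord max_card.
apply: ler_wpM2l; first by rewrite mulr_ge0 ?(ltW d0).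
have rho0 : 0 <= rho by rewrite mulr_ge0 ?spectral_norm_ge0 ?(ltW d0).
rewrite ler_pdivlMr ?subr_gt0 //; nra.
Qed.
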